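(* Assume the standing assumptions below and let $X_*$ be the unique symmetric positive semidefinite solution of $$\mathscr R(X):=A^{\mathsf T}X+XA+Q+\Pi_{11}(X)-[XB+L+\Pi_{12}(X)][R+\Pi_{22}(X)]^{-1}[XB+L+\Pi_{12}(X)]^{\mathsf T}=0.$$ Let $X_0=0$ and, for $k\ge0$, let $X_{k+1}$ be the stabilizing solution of the CARE $A_k^{\mathsf T}X+XA_k-XG_kX+H_k=0$ with $A_k=A_{\mathrm c}(X_k)$, $G_k=G_{\mathrm c}(X_k)$, $H_k=H_{\mathrm c}(X_k)$. Then: (i) $0=X_0\preceq X_1\preceq\cdots\preceq X_k\preceq X_*$, $\mathscr R(X_k)\succeq0$, and all eigenvalues of $A_k-G_kX_*$ lie in the open left half-plane, for all $k\ge0$; (ii) $\lim_{k\to\infty}X_k=X_*\succeq0$ and all eigenvalues of $A_{\mathrm c}(X_* )-G_{\mathrm c}(X_* )X_*$ lie in the closed left half-plane $\{\mathrm{Re}\,\lambda\le 0\}$.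
   Context: Data: $A,Q\in\mathbb{R}^{n\times n}$, $B,L\in\mathbb{R}^{n\times m}$, $R\in\mathbb{R}^{m\times m}$, $A_0^i\in\mathbb{R}^{n\times n}$, $B_0^i\in\mathbb{R}^{n\times m}$ ($i=1,\dots,r$); $A_0^0=A$, $B_0^0=B$. For symmetric $X$: $\Pi_{11}(X)=\sum_{i=1}^r (A_0^i)^{\mathsf T}XA_0^i$, $\Pi_{12}(X)=\sum_i (A_0^i)^{\mathsf T}XB_0^i$, $\Pi_{22}(X)=\sum_i (B_0^i)^{\mathsf T}XB_0^i$; $L_{\mathrm c}=L+\Pi_{12}$, $R_{\mathrm c}=R+\Pi_{22}$, $Q_{\mathrm c}=Q+\Pi_{11}$; $A_{\mathrm c}(X)=A-BR_{\mathrm c}(X)^{-1}L_{\mathrm c}(X)^{\mathsf T}$, $G_{\mathrm c}(X)=BR_{\mathrm c}(X)^{-1}B^{\mathsf T}$, $H_{\mathrm c}(X)=Q_{\mathrm c}(X)-L_{\mathrm c}(X)R_{\mathrm c}(X)^{-1}L_{\mathrm c}(X)^{\mathsf T}$. Standing assumptions: (1) $R\succ0$, $\begin{bmatrix}Q&L\\L^{\mathsf T}&R\end{bmatrix}\succeq0$; (2) there is $F\in\mathbb{R}^{m\times n}$ with $\dot S=(A+BF)S+S(A+BF)^{\mathsf T}+\sum_{i=1}^r(A_0^i+B_0^iF)S(A_0^i+B_0^iF)^{\mathsf T}$ exponentially stable; (3) with $C^{\mathsf T}C=Q-LR^{-1}L^{\mathsf T}$, $C\in\mathbb{R}^{p\times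 n}$, and $\widetilde A_0^i=A_0^i-B_0^iR^{-1}L^{\mathsf T}$, there is $K\in\mathbb{R}^{n\times p}$ with $\dot S=(\widetilde A_0^0+KC)S+S(\widetilde A_0^0+KC)^{\mathsf T}+\sum_{i=1}^r\widetilde A_0^iS(\widetilde A_0^i)^{\mathsf T}$ exponentially stable; (4) $\mathcal N(Q-LR^{-1}L^{\mathsf T})\subseteq\mathcal N(L^{\mathsf T})\cap\bigcap_i\mathcal N(A_0^i)$; (5) $(A,B)$ stabilizable and $(Q-LR^{-1}L^{\mathsf T},A)$ detectable (standard PBH-type definitions). Under (1)–(3), the equation $\mathscr R(X)=0$ has a unique positive semidefinite solution $X_*$, which is stabilizing. A stabilizing solution of a CARE $\mathcal A^{\mathsf T}X+X\mathcal A-X\mathcal GX+\mathcal H=0$ is a symmetric solution with $\mathcal A-\mathcal GX$ having all eigenvalues in the open left half-plane. *)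

(* Defs.v *)
From HB Require Import structures.
From mathcomp Require Import all_boot all_order all_algebra.
From mathcomp Require Import all_classical all_reals all_analysis.
From mathcomp Require Import complex.
Set Implicit Arguments. Unset Strict Implicit. Unset Printing Implicit Defensive.
Import Order.TTheory GRing.Theory Num.Theory.
Import numFieldNormedType.Exports.
Local Open Scope ring_scope.

Section Defs.
Variable R : realType.

Definition cmx (k l : nat) (M : 'M[R]_(k, l)) : 'M[R[i]]_(k, l) :=
  map_mx (fun x : R => Complex x 0) M.

Definition hurwitz (k : nat) (M : 'M[R]_k) : Prop :=
  forall z : R[i], eigenvalue (cmx M) z -> Re z < 0.

Definition symmetric (k : nat) (M : 'M[R]_k) : Prop := M^T = M.

Definition psd (k : nat) (M : 'M[R]_k) : Prop :=
  symmetric M /\ forall x : 'cV[R]_k, 0 <= (x^T *m M *m x) 0 0.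

Definition posdef (k : nat) (M : 'M[R]_k) : Prop :=
  symmetric M /\ forall x : 'cV[R]_k, x != 0 -> 0 < (x^T *m M *m x) 0 0.

Definition loewner_le (k : nat) (X Y : 'M[R]_k) : Prop := psd (Y - X).

Definition exp_stable (k : nat) (Lop : 'M[R]_k -> 'M[R]_k) : Prop :=
  exists c alpha : R, 0 < c /\ 0 < alpha /\
    forall S : R -> 'M[R]_k,
      (forall t, symmetric (S t)) ->
      (forall t : R, is_derive (t : R^o) (1 : R^o) S (Lop (S t))) ->
      forall t, 0 <= t -> `|S t| <= c * expR (- (alpha * t)) * `|S 0|.

(* PBH stabilizability of (A, B) *)
Definition stabilizable (k l : nat) (A : 'M[R]_k) (B : 'M[R]_(k, l)) : Prop :=
  forall (lam : R[i]) (w : 'rV[R[i]]_k), 0 <= Re lam -> w != 0 ->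
    w *m cmx A = lam *: w -> w *m cmx B != 0.

(* PBH detectability of (C, A) *)
Definition detectable (k l : nat) (C : 'M[R]_(l, k)) (A : 'M[R]_k) : Prop :=
  forall (lam : R[i]) (v : 'cV[R[i]]_k), 0 <= Re lam -> v != 0 ->
    cmx A *m v = lam *: v -> cmx C *m v != 0.

Definition stab_sol (k : nat) (Ak Gk Hk X : 'M[R]_k) : Prop :=
  symmetric X /\ Ak^T *m X + X *m Ak - X *m Gk *m X + Hk = 0 /\
  hurwitz (Ak - Gk *m X).

Variables (n m r : nat) (A Q : 'M[R]_n) (B L : 'M[R]_(n, m)) (Rm : 'M[R]_m)
  (A0 : 'I_r -> 'M[R]_n) (B0 : 'I_r -> 'M[R]_(n, m)).

Definition Pi11 (X : 'M[R]_n) : 'M[R]_n := \sum_(i < r) (A0 i)^T *m X *m A0 i.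
Definition Pi12 (X : 'M[R]_n) : 'M[R]_(n, m) := \sum_(i < r) (A0 i)^T *m X *m B0 i.
Definition Pi22 (X : 'M[R]_n) : 'M[R]_m := \sum_(i < r) (B0 i)^T *m X *m B0 i.
Definition Lc X := L + Pi12 X.
Definition Rc X := Rm + Pi22 X.
Definition Qc X := Q + Pi11 X.
Definition Ac X := A - B *m invmx (Rc X) *m (Lc X)^T.
Definition Gc X := B *m invmx (Rc X) *m B^T.
Definition Hc X := Qc X - Lc X *m invmx (Rc X) *m (Lc X)^T.

Definition Ric (X : 'M[R]_n) : 'M[R]_n :=
  A^T *m X + X *m A + Q + Pi11 X
  - (X *m B + L + Pi12 X) *m invmx (Rm + Pi22 X) *m (X *m B + L + Pi12 X)^T.

End Defs.

(* Main.v *)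
(* Write [care Y X] for the left-hand side of the CARE frozen at [Y], so that [Ric X = care X X].  Its quadratic form is the minimum over the input [u] of a Hamiltonian that is nondecreasing in [Y]; hence [Y <= Z] implies [care Y X <= care Z X].

Detectability, together with the kernel hypothesis (4), transfers to every frozen CARE, and an eigenvector argument then shows that [Ac Y - Gc Y Z] is Hurwitz for all positive semidefinite [Y], [Z] with [care Y Z <= 0].  This applies to [Z = Xs] whenever [0 <= Y <= Xs], since [care Y Xs <= care Xs Xs = 0].  Thus [Xs] both starts a Newton-Kleinman iteration converging to the stabilizing solution of the CARE frozen at [Y], and dominates that solution.  The iterates therefore increase, stay below [Xs], and converge to a positive semidefinite zero of [Ric], which is [Xs] by uniqueness.  The Hurwitz criterion with [Y = Z = Xs] gives the last claim.

Everything rests on the Lyapunov theorem for Hurwitz matrices: a strict certificate comes from the Schur form by rapidly weighting its coordinates. *)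

Require Import Defs.
From HB Require Import structures.
From mathcomp Require Import all_boot all_order all_algebra.
From mathcomp Require Import all_classical all_reals all_analysis.
From mathcomp Require Import complex.
From mathcomp Require Import ring lra.
Import Order.TTheory GRing.Theory Num.Theory.
Import numFieldNormedType.Exports.
Local Open Scope classical_set_scope.
Local Open Scope ring_scope.
Set Implicit Arguments.
Unset Strict Implicit.
Unset Printing Implicit Defensive.

Local Notation symmx := Defs.symmetric.

(** * Quadratic forms *)

Section Dot.
Variable R : realType.

Definition dot k (u v : 'cV[R]_k) : R := (u^T *m v) 0 0.

Lemma dotE k (u v : 'cV[R]_k) : dot u v = \sum_i u i 0 * v i 0.
Proof. by rewrite /dot mxE; apply: eq_bigr => i _; rewrite mxE. Qed.

Lemma dotC k (u v : 'cV[R]_k) : dot u v = dot v u.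
Proof. by rewrite !dotE; apply: eq_bigr => i _; rewrite mulrC. Qed.

Lemma dotDr k (u v w : 'cV[R]_k) : dot u (v + w) = dot u v + dot u w.
Proof. by rewrite /dot mulmxDr mxE. Qed.

Lemma dotNr k (u v : 'cV[R]_k) : dot u (- v) = - dot u v.
Proof. by rewrite /dot mulmxN mxE. Qed.

Lemma dotZr k a (u v : 'cV[R]_k) : dot u (a *: v) = a * dot u v.
Proof. by rewrite /dot -scalemxAr mxE. Qed.

Lemma dot0r k (u : 'cV[R]_k) : dot u 0 = 0.
Proof. by rewrite /dot mulmx0 mxE. Qed.

Lemma dotDl k (u v w : 'cV[R]_k) : dot (u + v) w = dot u w + dot v w.
Proof. by rewrite dotC dotDr !(dotC w). Qed.

Lemma dotNl k (u v : 'cV[R]_k) : dot (- u) v = - dot u v.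
Proof. by rewrite dotC dotNr dotC. Qed.

Lemma dotZl k a (u v : 'cV[R]_k) : dot (a *: u) v = a * dot u v.
Proof. by rewrite dotC dotZr dotC. Qed.

Lemma dot0l k (u : 'cV[R]_k) : dot 0 u = 0.
Proof. by rewrite dotC dot0r. Qed.

Lemma dot_suml k I (s : seq I) (P : pred I) (u : I -> 'cV[R]_k) v :
  dot (\sum_(i <- s | P i) u i) v = \sum_(i <- s | P i) dot (u i) v.
Proof.
by apply: (big_morph (fun u => dot u v)) => [x y|]; rewrite ?dotDl ?dot0l.
Qed.

Lemma dot_sumr k I (s : seq I) (P : pred I) (u : I -> 'cV[R]_k) v :
  dot v (\sum_(i <- s | P i) u i) = \sum_(i <- s | P i) dot v (u i).
Proof. by rewrite dotC dot_suml; apply: eq_bigr => i _; rewrite dotC. Qed.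

Definition dot_lin := (dotDl, dotDr, dotNl, dotNr, dotZl, dotZr).

Lemma dot_mulr k l (M : 'M[R]_(k, l)) u v : dot u (M *m v) = dot (M^T *m u) v.
Proof. by rewrite /dot trmx_mul trmxK mulmxA. Qed.

Lemma dot_col_mx k l (a c : 'cV[R]_k) (b d : 'cV[R]_l) :
  dot (col_mx a b) (col_mx c d) = dot a c + dot b d.
Proof. by rewrite /dot tr_col_mx mul_row_col mxE. Qed.

Lemma dot_ge0 k (u : 'cV[R]_k) : 0 <= dot u u.
Proof. by rewrite dotE sumr_ge0 // => i _; rewrite -expr2 sqr_ge0. Qed.

Lemma dot_eq0 k (u : 'cV[R]_k) : (dot u u == 0) = (u == 0).
Proof.
apply/idP/eqP => [|->]; last by rewrite dot0r.
rewrite dotE psumr_eq0 => [|i _]; last by rewrite -expr2 sqr_ge0.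
move=> /allP h; apply/matrixP => i j; rewrite ord1 mxE.
by have /= := h i (mem_index_enum _); rewrite -expr2 sqrf_eq0 => /eqP.
Qed.

(** * Semidefiniteness through quadratic forms *)

Definition qf k (M : 'M[R]_k) (x : 'cV[R]_k) := dot x (M *m x).

Lemma qfE k (M : 'M[R]_k) x : (x^T *m M *m x) 0 0 = qf M x.
Proof. by rewrite /qf /dot mulmxA. Qed.

Lemma qfD k (M N : 'M[R]_k) x : qf (M + N) x = qf M x + qf N x.
Proof. by rewrite /qf mulmxDl dotDr. Qed.

Lemma qfN k (M : 'M[R]_k) x : qf (- M) x = - qf M x.
Proof. by rewrite /qf mulNmx dotNr. Qed.

Lemma qfZ k a (M : 'M[R]_k) x : qf (a *: M) x = a * qf M x.
Proof. by rewrite /qf -scalemxAl dotZr. Qed.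

Lemma qf0 k (x : 'cV[R]_k) : qf 0 x = 0.
Proof. by rewrite /qf mul0mx dot0r. Qed.

Lemma psdP k (M : 'M[R]_k) : psd M <-> symmx M /\ forall x, 0 <= qf M x.
Proof. by split=> -[sM h]; split=> // x; move: (h x); rewrite qfE. Qed.

Lemma posdefP k (M : 'M[R]_k) :
  posdef M <-> symmx M /\ forall x, x != 0 -> 0 < qf M x.
Proof. by split=> -[sM h]; split=> // x /h; rewrite qfE. Qed.

Lemma psd0 k : psd (0 : 'M[R]_k).
Proof. by apply/psdP; split=> [|x]; [exact: trmx0 | rewrite qf0]. Qed.

Lemma loewner_qf k (M N : 'M[R]_k) x : loewner_le M N -> qf M x <= qf N x.
Proof. by move=> /psdP[_ /(_ x)]; rewrite qfD qfN subr_ge0. Qed.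

Lemma posdef_psd k (M : 'M[R]_k) : posdef M -> psd M.
Proof.
move=> /posdefP[sM h]; apply/psdP; split=> // x.
by have [->|/h/ltW//] := eqVneq x 0; rewrite /qf dot0l.
Qed.

Lemma sym_dot k (M : 'M[R]_k) x y :
  symmx M -> dot x (M *m y) = dot (M *m x) y.
Proof. by move=> sM; rewrite dot_mulr sM. Qed.

Lemma posdef_unit k (M : 'M[R]_k) : posdef M -> M \in unitmx.
Proof.
move=> /posdefP[sM h]; rewrite -row_free_unit -kermx_eq0.
apply/rowV0P => v /sub_kermxP vM; apply/eqP; rewrite -trmx_eq0.
apply/negPn/negP => /h; rewrite /qf /dot trmxK mulmxA vM mul0mx mxE.
by rewrite ltxx.
Qed.

Lemma sym_inv k (M : 'M[R]_k) : symmx M -> symmx (invmx M).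
Proof. by rewrite /symmx trmx_inv => ->. Qed.

Lemma posdef_inv k (M : 'M[R]_k) : posdef M -> posdef (invmx M).
Proof.
move=> pM; have uM := posdef_unit pM; move/posdefP: pM => [sM h].
apply/posdefP; split=> [|x x0]; first exact: sym_inv.
have := h (invmx M *m x); rewrite /qf mulKVmx // dotC; apply.
apply: contraNneq x0 => e; by rewrite -[x](mulKVmx uM) e mulmx0.
Qed.

(** If [y = M x] were nonzero, the form at [x + t y] would be [2 t |y|^2 + t^2 qf M y], which is
    negative for small [t < 0]. *)
Lemma psd_null k (M : 'M[R]_k) x : psd M -> qf M x = 0 -> M *m x = 0.
Proof.
move=> /psdP[sM h] x0; apply/eqP; rewrite -dot_eq0; apply/negPn/negP => hn.
set y := M *m x in hn *.
have yp : 0 < dot y y by rewrite lt_def hn dot_ge0.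
have q (t : R) : 0 <= 2 * t * dot y y + t ^+ 2 * qf M y.
  have := h (x + t *: y); rewrite /qf mulmxDr -scalemxAr !dot_lin.
  rewrite (sym_dot x y sM) -/y -[dot x _]/(qf M x) x0 -[dot y (M *m y)]/(qf M y).
  by congr (_ <= _); ring.
have k0 := h y.
have d0 : 0 < 1 + qf M y by apply: ltr_pwDl.
(* The [1] in the denominator covers the case [qf M y = 0]. *)
have := q (- (dot y y / (1 + qf M y))).
set d := dot y y in yp *; set e := qf M y in k0 d0 *.
have -> : 2 * - (d / (1 + e)) * d + (- (d / (1 + e))) ^+ 2 * e
   = - (d ^+ 2 * (2 + e) / (1 + e) ^+ 2) by field; lra.
rewrite oppr_ge0 leNgt; move=> /negP; apply.
by rewrite divr_gt0 ?exprn_gt0 // mulr_gt0 ?exprn_gt0 //; lra.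
Qed.

(** A vanishing form makes [M] positive semidefinite, so [psd_null] annihilates every basis
    vector. *)
Lemma sym_qf0 k (M : 'M[R]_k) : symmx M -> (forall x, qf M x = 0) -> M = 0.
Proof.
move=> sM h; apply/matrixP => i j.
have : M *m (delta_mx j 0 : 'cV[R]_k) = 0.
  by apply: psd_null => //; apply/psdP; split=> // x; rewrite h.
by rewrite -colE => /matrixP/(_ i 0); rewrite !mxE.
Qed.

Lemma sym_qf_inj k (M N : 'M[R]_k) : symmx M -> symmx N ->
  (forall x, qf M x = qf N x) -> M = N.
Proof.
move=> sM sN h; apply/eqP; rewrite -subr_eq0; apply/eqP/sym_qf0.
  by rewrite /Defs.symmetric linearB /= sM sN.
by move=> x; rewrite qfD qfN h subrr.
Qed.

Lemma cauchy_schwarz k (M : 'M[R]_k) x y : psd M ->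
  dot x (M *m y) ^+ 2 <= qf M x * qf M y.
Proof.
move=> pM; have /psdP[sM h] := pM.
have [y0|y0] := eqVneq (qf M y) 0.
  by rewrite y0 (psd_null pM y0) dot0r expr0n mulr0.
have yp : 0 < qf M y by rewrite lt_def y0 h.
(* The form at this vector is the positive [qf M y] times the gap in the claimed inequality. *)
have := h (qf M y *: x - dot x (M *m y) *: y).
rewrite /qf mulmxBr -!scalemxAr !dot_lin -!/(qf M _).
rewrite (sym_dot y x sM) (dotC _ x).
set d := dot x _; set a := qf M x; set b := qf M y in yp *.
have -> : b * (b * a - d * d) + (- (d * (b * d)) - d * - (d * b))
   = b * (a * b - d ^+ 2) by ring.
by rewrite pmulr_rge0 // subr_ge0.
Qed.

Lemma qf_bound k (M : 'M[R]_k) :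
  exists2 c : R, 0 < c & forall x, `|qf M x| <= c * dot x x.
Proof.
pose c := 1 + \sum_i \sum_j `|M i j|.
have s0 : 0 <= \sum_i \sum_j `|M i j|.
  by apply: sumr_ge0 => i _; apply: sumr_ge0 => j _.
exists c => [|x]; first by rewrite /c; lra.
have xi i : `|x i 0| ^+ 2 <= dot x x.
  rewrite dotE (bigD1 i) //= real_normK ?num_real // -expr2 lerDl.
  by rewrite sumr_ge0 // => j _; rewrite -expr2 sqr_ge0.
apply: (@le_trans _ _ ((\sum_i \sum_j `|M i j|) * dot x x)); last first.
  by rewrite ler_wpM2r ?dot_ge0 // /c lerDr.
rewrite /qf dotE (le_trans (ler_norm_sum _ _ _)) // mulr_suml ler_sum // => i _.
rewrite mxE mulr_sumr (le_trans (ler_norm_sum _ _ _)) // mulr_suml ler_sum //.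
move=> j _; rewrite !normrM mulrCA ler_wpM2l //.
have := xi i; have := xi j; move: `|x i 0| `|x j 0| (dot x x) => a b d.
have := sqr_ge0 (a - b); nra.
Qed.

(* Cauchy-Schwarz for the form [M] applied to [x] and [M^-1 x]. *)
Lemma posdef_lower k (M : 'M[R]_k) : posdef M ->
  exists2 c : R, 0 < c & forall x, dot x x <= c * qf M x.
Proof.
move=> pM; have [c c0 hc] := qf_bound (invmx M); exists c => // x.
have uM := posdef_unit pM.
have := cauchy_schwarz x (invmx M *m x) (posdef_psd pM).
rewrite mulKVmx // /qf mulKVmx // -!/(qf M _) (dotC _ x) -/(qf _ x).
have /psdP[_ /(_ x) h1] := posdef_psd pM.
have /psdP[_ /(_ x) h2] := posdef_psd (posdef_inv pM).
have := hc x; rewrite ger0_norm // => h3 h4.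
have := dot_ge0 x; rewrite le_eqVlt => /predU1P[<-|d0].
  by rewrite mulr_ge0 // ltW.
rewrite -(ler_pM2r d0) -expr2 (le_trans h4) // [X in _ <= X]mulrAC.
by rewrite mulrC ler_wpM2r.
Qed.

End Dot.

(** * Complex eigenvalues and Lyapunov certificates *)

(** The Schur form, weakened to a similarity by an invertible [U]; [T] is lower triangular. Size [0]
    is separate because [Schur] asks for a positive size. *)
Lemma schur_trig (F : numClosedFieldType) k (A : 'M[F]_k) : exists U T : 'M[F]_k,
  [/\ U \in unitmx, is_trig_mx T, U *m A = T *m U &
      forall i, eigenvalue A (T i i)].
Proof.
case: k A => [|k] A.
  exists 1%:M, A; split; rewrite ?unitmx1 ?mul1mx ?mulmx1 //; last by case.
  by apply/is_trig_mxP; case.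
have [U uU tU] := Schur A (ltn0Sn k).
have {}uU := unitarymx_unit uU.
have tT : is_trig_mx (U *m A *m invmx U) by rewrite -conjumx.
exists U, (U *m A *m invmx U); split=> // [|i]; first by rewrite mulmxKV.
have /eigenvalueP[v vT v0] :
    eigenvalue (U *m A *m invmx U) ((U *m A *m invmx U) i i).
  rewrite eigenvalue_root_char char_poly_trig // /root horner_prod.
  by rewrite (bigD1 i) //= !hornerE subrr mul0r.
apply/eigenvalueP; exists (v *m U).
  by rewrite scalemxAl -vT !mulmxA mulmxKV.
by apply: contraNneq v0 => vU; rewrite -[v](mulmxK uU) vU mul0mx.
Qed.

Section Cplx.
Variable R : realType.
Local Notation C := R[i].
Local Notation Re := complex.Re.
Local Notation Im := complex.Im.
Implicit Types z w : C.

Lemma ReD z w : Re (z + w) = Re z + Re w. Proof. by case: z w => [? ?] []. Qed.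
Lemma ImD z w : Im (z + w) = Im z + Im w. Proof. by case: z; case: w. Qed.
Lemma ReM z w : Re (z * w) = Re z * Re w - Im z * Im w.
Proof. by case: z; case: w. Qed.
Lemma ImM z w : Im (z * w) = Re z * Im w + Im z * Re w.
Proof. by case: z; case: w. Qed.

Lemma Re_sum I (s : seq I) (P : pred I) (F : I -> C) :
  Re (\sum_(i <- s | P i) F i) = \sum_(i <- s | P i) Re (F i).
Proof. by apply: (big_morph (@Re R)) => // z w; rewrite ReD. Qed.

Lemma Im_sum I (s : seq I) (P : pred I) (F : I -> C) :
  Im (\sum_(i <- s | P i) F i) = \sum_(i <- s | P i) Im (F i).
Proof. by apply: (big_morph (@Im R)) => // z w; rewrite ImD. Qed.

Lemma complex_eq z w : Re z = Re w -> Im z = Im w -> z = w.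
Proof. by case: z w => [? ?] [? ?] /= -> ->. Qed.

Definition rmx k l (M : 'M[C]_(k, l)) : 'M[R]_(k, l) := map_mx (@Re R) M.
Definition imx k l (M : 'M[C]_(k, l)) : 'M[R]_(k, l) := map_mx (@Im R) M.

Lemma rmxE k l (M : 'M[C]_(k, l)) i j : rmx M i j = Re (M i j).
Proof. exact: mxE. Qed.

Lemma imxE k l (M : 'M[C]_(k, l)) i j : imx M i j = Im (M i j).
Proof. exact: mxE. Qed.

Lemma rmxM k l p (M : 'M[C]_(k, l)) (N : 'M[C]_(l, p)) :
  rmx (M *m N) = rmx M *m rmx N - imx M *m imx N.
Proof.
apply/matrixP => i j; rewrite !mxE Re_sum -sumrB; apply: eq_bigr => s _.
by rewrite ReM !mxE.
Qed.

Lemma imxM k l p (M : 'M[C]_(k, l)) (N : 'M[C]_(l, p)) :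
  imx (M *m N) = rmx M *m imx N + imx M *m rmx N.
Proof.
apply/matrixP => i j; rewrite !mxE Im_sum -big_split; apply: eq_bigr => s _.
by rewrite ImM !mxE.
Qed.

Lemma rmxZ k l z (M : 'M[C]_(k, l)) : rmx (z *: M) = Re z *: rmx M - Im z *: imx M.
Proof. by apply/matrixP => i j; rewrite !mxE ReM. Qed.

Lemma imxZ k l z (M : 'M[C]_(k, l)) : imx (z *: M) = Re z *: imx M + Im z *: rmx M.
Proof. by apply/matrixP => i j; rewrite !mxE ImM. Qed.

Lemma rmx_cmx k l (M : 'M[R]_(k, l)) : rmx (cmx M) = M.
Proof. by apply/matrixP => i j; rewrite !mxE. Qed.

Lemma imx_cmx k l (M : 'M[R]_(k, l)) : imx (cmx M) = 0.
Proof. by apply/matrixP => i j; rewrite !mxE. Qed.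

Lemma mx_complex_eq k l (M N : 'M[C]_(k, l)) :
  rmx M = rmx N -> imx M = imx N -> M = N.
Proof.
move=> /matrixP hr /matrixP hi; apply/matrixP => i j.
by have := hr i j; have := hi i j; rewrite !mxE => *; apply: complex_eq.
Qed.

Lemma mx_complex_surj k l (M N : 'M[R]_(k, l)) :
  exists P : 'M[C]_(k, l), rmx P = M /\ imx P = N.
Proof.
exists (\matrix_(i, j) Complex (M i j) (N i j)).
by split; apply/matrixP => i j; rewrite !mxE.
Qed.

(* In [hurwitz], [stabilizable] and [detectable], [Re] is the complex-valued real part of numClosedFieldType, not [complex.Re]. *)
Lemma NumRe z : numfield.Num.Theory.Re z = (Re z)%:C%C.
Proof. by rewrite complexRe. Qed.

Lemma NumRe_lt0 z : (numfield.Num.Theory.Re z < 0) = (Re z < 0).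
Proof. by rewrite NumRe ltcR. Qed.

Lemma NumRe_ge0 z : (0 <= numfield.Num.Theory.Re z) = (0 <= Re z).
Proof. by rewrite NumRe lecR. Qed.

(** The library's [eigenvalue] refers to row eigenvectors; this gives access to column ones. *)
Lemma eigenvalue_tr k (M : 'M[C]_k) z : eigenvalue M^T z = eigenvalue M z.
Proof.
rewrite !eigenvalue_root_char /char_poly.
suff -> : char_poly_mx M^T = (char_poly_mx M)^T by rewrite det_tr.
by rewrite /char_poly_mx linearB /= tr_scalar_mx map_trmx.
Qed.

(** With [v = a + i b] and [z = al + i be], the equation [M v = z v] splits into the two real ones,
    so stability can be tested on real vectors. *)
Lemma hurwitzI k (M : 'M[R]_k) :
  (forall al be (a b : 'cV[R]_k), ~ (a = 0 /\ b = 0) ->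
    M *m a = al *: a - be *: b -> M *m b = be *: a + al *: b -> al < 0) ->
  hurwitz M.
Proof.
move=> h z; rewrite -eigenvalue_tr => /eigenvalueP[v vM v0].
have {}vM : cmx M *m v^T = z *: v^T.
  by rewrite -[LHS]trmxK trmx_mul trmxK vM linearZ.
rewrite NumRe_lt0; apply: (h _ (Im z) (rmx v^T) (imx v^T)).
- case=> r0 i0; case/eqP: v0; rewrite -[v]trmxK -[RHS]trmxK; congr trmx.
  apply: mx_complex_eq; rewrite ?r0 ?i0; apply/matrixP => i j;
  by rewrite !mxE.
- by have := congr1 (@rmx _ _) vM; rewrite rmxM rmxZ rmx_cmx imx_cmx mul0mx subr0.
- have := congr1 (@imx _ _) vM; rewrite imxM imxZ rmx_cmx imx_cmx mul0mx addr0.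
  by rewrite addrC.
Qed.

Lemma detectable_real k l (D : 'M[R]_(l, k)) (A : 'M[R]_k) al be (a b : 'cV[R]_k) :
  detectable D A -> 0 <= al ->
  A *m a = al *: a - be *: b -> A *m b = be *: a + al *: b ->
  D *m a = 0 -> D *m b = 0 -> a = 0 /\ b = 0.
Proof.
move=> hd al0 ha hb Da Db; have [v [ra ib]] := mx_complex_surj a b.
have [v0|v0] := eqVneq v 0.
  rewrite -ra -ib v0; split; apply/matrixP => i j; by rewrite !mxE.
have al0' : 0 <= numfield.Num.Theory.Re (Complex al be) by rewrite NumRe_ge0.
suff hv : cmx A *m v = Complex al be *: v.
  case/negP: (hd (Complex al be) v al0' v0 hv); apply/eqP/mx_complex_eq.
    rewrite rmxM rmx_cmx imx_cmx mul0mx subr0 ra Da.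
    by apply/matrixP => i j; rewrite !mxE.
  rewrite imxM rmx_cmx imx_cmx mul0mx addr0 ib Db.
  by apply/matrixP => i j; rewrite !mxE.
apply: mx_complex_eq.
  by rewrite rmxM rmxZ rmx_cmx imx_cmx mul0mx subr0 ra ib.
by rewrite imxM imxZ rmx_cmx imx_cmx mul0mx addr0 ra ib addrC.
Qed.

(* Re (conj z * w) *)
Definition redot z w : R := Re z * Re w + Im z * Im w.

Lemma redotDr z w1 w2 : redot z (w1 + w2) = redot z w1 + redot z w2.
Proof. by rewrite /redot ReD ImD; ring. Qed.

Lemma redot_ge0 z : 0 <= redot z z.
Proof. by rewrite /redot -!expr2 addr_ge0 ?sqr_ge0. Qed.

Lemma redot_eq0 z : (redot z z == 0) = (z == 0).
Proof.
by case: z => a b; rewrite /redot -!expr2 paddr_eq0 ?sqr_ge0 // !sqrf_eq0 eq_complex.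
Qed.

(** Young's inequality, from [|z - g w|^2 >= 0]. *)
Lemma redot_cross z w g : redot z (g * w) <= (redot z z + redot g g * redot w w) / 2.
Proof.
case: z w g => [z1 z2] [w1 w2] [g1 g2]; rewrite /redot /=.
have := sqr_ge0 (z1 - (g1 * w1 - g2 * w2)).
have := sqr_ge0 (z2 - (g1 * w2 + g2 * w1)); nra.
Qed.

(** Induction on the size, splitting off the first coordinate: by lower triangularity it evolves on
    its own, and a large weight on it absorbs its effect on the others. *)
Lemma trig_weights k (T : 'M[C]_k) : is_trig_mx T -> (forall i, Re (T i i) < 0) ->
  exists2 d : 'I_k -> R, (forall i, 0 < d i) & forall y : 'cV[C]_k,
    \sum_i d i * redot (y i 0) ((T *m y) i 0) <= - \sum_i redot (y i 0) (y i 0).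
Proof.
elim: k T => [|k IH] T /is_trig_mxP tT nT.
  by exists (fun=> 1) => // y; rewrite !big_ord0 oppr0.
pose T' := \matrix_(i, j) T (lift ord0 i) (lift ord0 j).
have [] := IH T'.
- by apply/is_trig_mxP => i j ij; rewrite mxE tT // /bump.
- by move=> i; rewrite mxE.
move=> d d0 hd.
(* [K] measures what the first coordinate feeds into the others. Below, [s * lam = 1 + K]: the part
   [K] pays for this and [1] is left as decay. *)
pose K := \sum_i d i ^+ 2 * redot (T (lift ord0 i) ord0) (T (lift ord0 i) ord0).
have K0 : 0 <= K.
  by apply: sumr_ge0 => i _; rewrite mulr_ge0 ?redot_ge0 // sqr_ge0.
pose lam := - Re (T ord0 ord0); have lam0 : 0 < lam by rewrite oppr_gt0 nT.
pose s := (1 + K) / lam; have s0 : 0 < s by rewrite divr_gt0 //; lra.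
(* Doubling the old weights doubles their decay; one half is spent on the cross terms. *)
exists (fun i => if unlift ord0 i is Some j then 2 * d j else s) => [i|y].
  by case: unliftP => [j|] _ //; rewrite mulr_gt0.
pose y' : 'cV[C]_k := \col_j y (lift ord0 j) 0.
have y'E i : y (lift ord0 i) 0 = y' i 0 by rewrite mxE.
rewrite !big_ord_recl /= unlift_none.
under eq_bigr do rewrite liftK.
set c := y ord0 0.
have -> : (T *m y) ord0 0 = T ord0 ord0 * c.
  rewrite mxE big_ord_recl big1 ?addr0 // => j _.
  by rewrite tT ?mul0r.
have -> : redot c (T ord0 ord0 * c) = - lam * redot c c.
  by rewrite /redot ReM ImM /lam; ring.
have e i : (T *m y) (lift ord0 i) 0 = T (lift ord0 i) ord0 * c + (T' *m y') i 0.
  rewrite mxE big_ord_recl; congr (_ + _); rewrite mxE.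
  by apply: eq_bigr => j _; rewrite !mxE.
have -> : \sum_i redot (y (lift ord0 i) 0) (y (lift ord0 i) 0)
   = \sum_i redot (y' i 0) (y' i 0) by apply: eq_bigr => i _; rewrite mxE.
have -> : \sum_i 2 * d i * redot (y (lift ord0 i) 0) ((T *m y) (lift ord0 i) 0)
   = \sum_i 2 * redot (y' i 0) ((d i)%:C%C * T (lift ord0 i) ord0 * c)
     + 2 * \sum_i d i * redot (y' i 0) ((T' *m y') i 0).
  rewrite mulr_sumr -big_split; apply: eq_bigr => i _ /=.
  by rewrite e redotDr y'E /redot !(ReM, ImM) /=; ring.
have := hd y'; set S := \sum_i redot (y' i 0) (y' i 0).
set S1 := \sum_i d i * _; set S2 := \sum_i 2 * _.
suff : S2 <= S + K * redot c c.
  have -> : s * (- lam * redot c c) = - (1 + K) * redot c c.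
    by rewrite /s; field; lra.
  by move: (redot_ge0 c); lra.
rewrite /S2 /S /K mulr_suml -big_split ler_sum // => i _ /=.
have := redot_cross (y' i 0) c ((d i)%:C%C * T (lift ord0 i) ord0).
rewrite {3}/redot !(ReM, ImM) /= => h.
set t := T _ _ in h *.
have -> : d i ^+ 2 * redot t t * redot c c = ((d i * Re t - 0 * Im t) * (d i * Re t - 0 * Im t) +
        (d i * Im t + 0 * Re t) * (d i * Im t + 0 * Re t)) * redot c c.
  by rewrite /redot; ring.
by move: h; lra.
Qed.

(** The weights are carried back through [U A = T U]: at a real [x] the form of [P] is the weighted
    sum of the [|(U x)_i|^2], and it decreases along [A] by [trig_weights]. *)
Lemma lyapunov_certificate k (A : 'M[R]_k) : hurwitz A ->
  exists2 P : 'M[R]_k, posdef P & forall x, x != 0 -> dot (P *m x) (A *m x) < 0.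
Proof.
move=> hA; have [U [T [uU tT UA eT]]] : exists U T : 'M[C]_k,
    [/\ U \in unitmx, is_trig_mx T, U *m cmx A = T *m U &
      forall i, eigenvalue (cmx A) (T i i)] := schur_trig (cmx A : 'M[C]_k).
have [|d d0 hd] := trig_weights tT.
  by move=> i; rewrite -NumRe_lt0; apply/hA/eT.
pose D := diag_mx (\row_i d i).
(* The real part of [U^* D U]. *)
pose P := (rmx U)^T *m D *m rmx U + (imx U)^T *m D *m imx U.
have DE u v : dot u (D *m v) = \sum_i d i * (u i 0 * v i 0).
  rewrite dotE; apply: eq_bigr => i _.
  by rewrite mul_diag_mx !mxE; ring.
have PE x y : dot x (P *m y) =
    \sum_i d i * redot ((U *m cmx x) i 0) ((U *m cmx y) i 0).
  rewrite mulmxDl dotDr -!mulmxA !dot_mulr !trmxK -!dot_mulr !DE -big_split.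

  apply: eq_bigr => i _ /=; rewrite -mulrDr /redot -!rmxE -!imxE.
  by rewrite !rmxM !imxM !rmx_cmx !imx_cmx !mulmx0 !subr0 !add0r.
have nP (e : 'I_k -> R) (x : 'cV[R]_k) : (forall i, 0 < e i) -> x != 0 ->
    0 < \sum_i e i * redot ((U *m cmx x) i 0) ((U *m cmx x) i 0).
  move=> e0 x0; have ge i : 0 <= e i * redot ((U *m cmx x) i 0) ((U *m cmx x) i 0).
    by rewrite mulr_ge0 ?redot_ge0 // ltW.
  rewrite lt_def sumr_ge0 ?andbT //; apply: contraNneq x0 => /eqP.
  rewrite psumr_eq0 // => /allP h.
  have : U *m cmx x = 0.
    apply/matrixP => i j; rewrite (ord1 j) [RHS]mxE; apply/eqP.
    have /= := h i (mem_index_enum _).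
    by rewrite mulf_eq0 (gt_eqF (e0 i)) /= redot_eq0.
  move=> /(congr1 (mulmx (invmx U))); rewrite mulKmx // mulmx0 => x0.
  rewrite -[x]rmx_cmx x0; apply/eqP/matrixP => i j; by rewrite !mxE.
have sP : symmx P.
  by rewrite /Defs.symmetric linearD /= !trmx_mul !trmxK tr_diag_mx !mulmxA.
exists P => [|x x0].
  by apply/posdefP; split=> // x x0; rewrite /qf PE nP.
rewrite -sym_dot // PE.
have -> : cmx (A *m x) = cmx A *m cmx x.
  by apply: mx_complex_eq; rewrite ?rmxM ?imxM !rmx_cmx !imx_cmx
     ?mul0mx ?mulmx0 ?subr0 ?add0r.
rewrite mulmxA UA -mulmxA (le_lt_trans (hd _)) // oppr_lt0.
by have := nP (fun=> 1) x (fun=> ltr01) x0; under eq_bigr do rewrite mul1r.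
Qed.

End Cplx.

(** * Lyapunov equations *)

Section Lyapunov.
Variable R : realType.

(* [X + s P] with [P] a strict certificate cannot be positive semidefinite and singular for [s > 0], so the least [s >= 0] making it positive semidefinite is [0]. *)
Lemma lyapunov_psd k (A X : 'M[R]_k) : hurwitz A -> symmx X ->
  (forall x, dot (X *m x) (A *m x) <= 0) -> psd X.
Proof.
move=> hA sX hX; have [P pP cP] := lyapunov_certificate hA.
have [K K0 hK] := qf_bound X; have [c c0 hc] := posdef_lower pP.
have [sP P0] := (posdefP P).1 pP.
pose S := [set s : R | 0 <= s /\ forall x, 0 <= qf X x + s * qf P x].
(* [qf X x >= - K |x|^2 >= - K c qf P x]. *)
have SKc : S (K * c).
  split=> [|x]; first by rewrite mulr_ge0 ?ltW.
  have := hK x; rewrite ler_norml => /andP[+ _].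
  have : K * dot x x <= K * (c * qf P x) by rewrite ler_pM2l.
  lra.
have lS : lbound S 0 by move=> s [].
have hS : has_inf S by split; [exists (K * c)|exists 0].
have s0 : 0 <= inf S by apply: lb_le_inf => //; exists (K * c).
(* The infimum is attained: at a nonzero [x], membership reads [s >= - qf X x / qf P x], a bound
   that passes to [inf S]. *)
have psdM x : 0 <= qf X x + inf S * qf P x.
  have [->|x0] := eqVneq x 0; first by rewrite /qf !dot0l mulr0 addr0.
  have px := P0 x x0; rewrite -[qf X x]opprK addrC subr_ge0 -ler_pdivrMr //.
  apply: lb_le_inf; first by exists (K * c).
  by move=> s [_ /(_ x)]; rewrite ler_pdivrMr //; lra.
move: s0; rewrite le_eqVlt => /predU1P[e|s0].
  by apply/psdP; split=> // x; have := psdM x; rewrite -e mul0r addr0.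
pose M := X + inf S *: P.
have qM x : qf M x = qf X x + inf S * qf P x by rewrite qfD qfZ.
have sM : symmx M by rewrite /Defs.symmetric linearD linearZ /= sX sP.
have pM : psd M by apply/psdP; split=> // x; rewrite qM.
have {}pM : posdef M.
  apply/posdefP; split=> // x x0; rewrite lt_def.
  have /psdP[_ ->] := pM; rewrite andbT; apply/eqP => /(psd_null pM) Mx.
  have : dot (M *m x) (A *m x) = 0 by rewrite Mx dot0l.
  rewrite mulmxDl -scalemxAl !dot_lin.
  have := hX x; have : inf S * dot (P *m x) (A *m x) < 0.
    by rewrite pmulr_rlt0 // cP.
  lra.
have [c' c'0 hc'] := posdef_lower pM; have [K' K'0 hK'] := qf_bound P.
(* The positive definite [M] dominates [(c' K')^-1 P], so [s] can still drop by [d]; the minimum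
   keeps [inf S - d] nonnegative. *)
pose d := Num.min (c' * K')^-1 (inf S).
have d0 : 0 < d by rewrite lt_min s0 invr_gt0 mulr_gt0.
have : S (inf S - d).
  split=> [|x]; first by rewrite subr_ge0 ge_min lexx orbT.
  rewrite mulrBl addrA -qM subr_ge0.
  have qP : qf P x <= c' * K' * qf M x.
    have h1 := hc' x; have h2 := le_trans (ler_norm _) (hK' x).
    by rewrite (le_trans h2) // mulrAC mulrC ler_pM2r.
  have P0' := ((psdP P).1 (posdef_psd pP)).2 x.
  apply: (@le_trans _ _ ((c' * K')^-1 * qf P x)).
    by rewrite ler_wpM2r // ge_min lexx.
  by rewrite mulrC ler_pdivrMr ?mulr_gt0 // mulrC.
move=> /(ge_inf (ex_intro _ 0 lS)); lra.
Qed.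

(* On symmetric matrices this is the Lyapunov operator; the term [X - X^T] makes it injective on all matrices, so that solvability follows by counting dimensions. *)
Definition lyap_map k (A X : 'M[R]_k) : 'M[R]_k :=
  A^T *m (X + X^T) + (X + X^T) *m A + (X - X^T).

Lemma lyap_map_is_linear k (A : 'M[R]_k) : linear (@lyap_map k A).
Proof.
move=> a X Y; rewrite /lyap_map linearP /= !mulmxDr !mulmxDl -!scalemxAr -!scalemxAl.
apply/matrixP => i j; rewrite !mxE; ring.
Qed.

HB.instance Definition _ k (A : 'M[R]_k) :=
  GRing.isLinear.Build R 'M[R]_k 'M[R]_k _ (@lyap_map k A) (lyap_map_is_linear A).

(** Transposing the equation preserves the terms in [X + X^T] and flips the sign of [X - X^T], which
    must therefore vanish. *)
Lemma lyap_map_sym k (A X H : 'M[R]_k) : symmx H -> lyap_map A X = H ->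
  X^T = X /\ A^T *m (X + X) + (X + X) *m A = H.
Proof.
move=> sH e; have ST : (X + X^T)^T = X + X^T.
  by rewrite linearD /= trmxK addrC.
have XT : X^T = X.
  have := congr1 trmx e; rewrite sH -e /lyap_map.
  move: (X + X^T) ST => S ST.
  rewrite !(linearD, linearN) /= !trmx_mul ST !trmxK (addrC (A^T *m S)).
  by move=> /addrI e'; apply/matrixP => i j; move/matrixP/(_ i j): e';
     rewrite !mxE; lra.
by split=> //; rewrite -e /lyap_map XT subrr addr0.
Qed.

(** [lyapunov_psd] applies to both [X] and [- X]. *)
Lemma lyapunov_sum0 k (A X : 'M[R]_k) : hurwitz A -> symmx X ->
  A^T *m X + X *m A = 0 -> X = 0.
Proof.
move=> hA sX e.
have h x : dot (X *m x) (A *m x) = 0.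
  have : dot x ((A^T *m X + X *m A) *m x) = 0 by rewrite e mul0mx dot0r.
  rewrite mulmxDl dotDr -!mulmxA dot_mulr trmxK.
  by rewrite (sym_dot x (A *m x) sX) (dotC (A *m x)); lra.
have p1 : psd X by apply: (lyapunov_psd hA) => // x; rewrite h.
have /psdP[_ p2] : psd (- X).
  apply: (lyapunov_psd hA) => [|x]; first by rewrite /Defs.symmetric linearN /= sX.
  by rewrite mulNmx dotNl h oppr0.
apply: sym_qf0 => // x; apply/eqP; rewrite eq_le -oppr_ge0 -qfN p2.
by have /psdP[_] := p1; apply.
Qed.

Lemma lyapunov_solve k (A H : 'M[R]_k) : hurwitz A -> symmx H ->
  exists2 X : 'M[R]_k, symmx X & A^T *m X + X *m A + H = 0.
Proof.
move=> hA sH.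
have ker X : lyap_map A X = 0 -> X = 0.
  move=> /(lyap_map_sym _)[|XT e]; first exact: trmx0.
  have sX : symmx (X + X) by rewrite /Defs.symmetric linearD /= XT.
  have /matrixP h := lyapunov_sum0 hA sX e.
  by apply/matrixP => i j; have := h i j; rewrite !mxE; lra.
(* An injective endomorphism of the finite-dimensional space of matrices is invertible. *)
have uL : lin_mx (lyap_map A) \in unitmx.
  rewrite -row_free_unit -kermx_eq0; apply/rowV0P => v /sub_kermxP.
  rewrite mul_rV_lin => /(congr1 vec_mx); rewrite mxvecK linear0 => /ker.
  by move=> /(congr1 mxvec); rewrite vec_mxK linear0.
pose X := vec_mx (mxvec (- H) *m invmx (lin_mx (lyap_map A))).
have : lyap_map A X = - H.
  by rewrite -mx_rV_lin mulmxKV // mxvecK.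
move=> /(lyap_map_sym _)[|XT e]; first by rewrite /Defs.symmetric linearN /= sH.
exists (X + X); first by rewrite /Defs.symmetric linearD /= XT.
by rewrite e addNr.
Qed.

End Lyapunov.

(** * Entrywise convergence of matrices *)

Section Convergence.
Variable R : realType.

(** Stated by entries so that matrix operations reduce to scalar limit rules; [mcvg_cvg] returns to
    the matrix topology. *)
Definition mcvg k l (X : nat -> 'M[R]_(k, l)) (Y : 'M[R]_(k, l)) :=
  forall i j, (fun n => X n i j) @ \oo --> Y i j.

Lemma mcvg_cst k l (Y : 'M[R]_(k, l)) : mcvg (fun=> Y) Y.
Proof. by move=> i j; exact: cvg_cst. Qed.

Arguments mcvg_cst {k l} Y.

Lemma mcvgD k l (X X' : nat -> 'M[R]_(k, l)) Y Y' :
  mcvg X Y -> mcvg X' Y' -> mcvg (fun n => X n + X' n) (Y + Y').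
Proof.
move=> h h' i j; rewrite mxE; under eq_fun do rewrite mxE.
exact: cvgD (h i j) (h' i j).
Qed.

Lemma mcvgN k l (X : nat -> 'M[R]_(k, l)) Y :
  mcvg X Y -> mcvg (fun n => - X n) (- Y).
Proof.
by move=> h i j; rewrite mxE; under eq_fun do rewrite mxE; exact: cvgN (h i j).
Qed.

Lemma cvg_sumr I (s : seq I) (u : I -> nat -> R) (v : I -> R) :
  (forall i, u i @ \oo --> v i) ->
  (fun n => \sum_(i <- s) u i n) @ \oo --> \sum_(i <- s) v i.
Proof.
move=> h; elim: s => [|i s IH].
  by rewrite big_nil; under eq_fun do rewrite big_nil; exact: cvg_cst.
rewrite big_cons; under eq_fun do rewrite big_cons.
exact: cvgD (h i) IH.
Qed.

Lemma cvg_prodr I (s : seq I) (u : I -> nat -> R) (v : I -> R) :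
  (forall i, u i @ \oo --> v i) ->
  (fun n => \prod_(i <- s) u i n) @ \oo --> \prod_(i <- s) v i.
Proof.
move=> h; elim: s => [|i s IH].
  by rewrite big_nil; under eq_fun do rewrite big_nil; exact: cvg_cst.
rewrite big_cons; under eq_fun do rewrite big_cons.
exact: cvgM (h i) IH.
Qed.

Lemma mcvgM k l p (X : nat -> 'M[R]_(k, l)) (X' : nat -> 'M[R]_(l, p)) Y Y' :
  mcvg X Y -> mcvg X' Y' -> mcvg (fun n => X n *m X' n) (Y *m Y').
Proof.
move=> h h' i j; rewrite mxE; under eq_fun do rewrite mxE.
apply: cvg_sumr => s; exact: cvgM (h _ _) (h' _ _).
Qed.

Lemma mcvgT k l (X : nat -> 'M[R]_(k, l)) Y :
  mcvg X Y -> mcvg (fun n => (X n)^T) Y^T.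
Proof. by move=> h i j; rewrite mxE; under eq_fun do rewrite mxE; exact: h. Qed.

Lemma mcvg_sum k l I (s : seq I) (X : I -> nat -> 'M[R]_(k, l)) Y :
  (forall i, mcvg (X i) (Y i)) ->
  mcvg (fun n => \sum_(i <- s) X i n) (\sum_(i <- s) Y i).
Proof.
move=> h i j; rewrite summxE; under eq_fun do rewrite summxE.
by apply: cvg_sumr => t; exact: h.
Qed.

Lemma mcvg_det k (X : nat -> 'M[R]_k) Y :
  mcvg X Y -> (fun n => \det (X n)) @ \oo --> \det Y.
Proof.
move=> h; apply: cvg_sumr => s; apply: cvgM; first exact: cvg_cst.
by apply: cvg_prodr => i; exact: h.
Qed.

(** Adjugate over determinant. The unit hypotheses select this branch of [invmx], which leaves
    singular matrices unchanged. *)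
Lemma mcvg_inv k (X : nat -> 'M[R]_k) Y :
  (forall n, X n \in unitmx) -> Y \in unitmx -> mcvg X Y ->
  mcvg (fun n => invmx (X n)) (invmx Y).
Proof.
move=> uX uY h i j; rewrite /invmx uY mxE.
under eq_fun do rewrite uX mxE.
apply: cvgM.
  apply: cvgV; last exact: mcvg_det.
  by rewrite -unitfE -unitmxE.
rewrite mxE; under eq_fun do rewrite mxE.
apply: cvgM; first exact: cvg_cst.
by apply: mcvg_det => a b; rewrite !mxE; under eq_fun do rewrite !mxE; exact: h.
Qed.

Lemma mcvg_unique k l (X : nat -> 'M[R]_(k, l)) Y Z : mcvg X Y -> mcvg X Z -> Y = Z.
Proof. by move=> hY hZ; apply/matrixP => i j; exact: cvg_unique (hY i j) (hZ i j). Qed.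

Lemma mcvgS k l (X : nat -> 'M[R]_(k, l)) Y : mcvg X Y -> mcvg (fun n => X n.+1) Y.
Proof. by move=> h i j; have := h i j; rewrite -cvg_shiftS. Qed.

Lemma mcvg_cvg k l (X : nat -> 'M[R]_(k, l)) Y : mcvg X Y -> X @ \oo --> Y.
Proof.
move=> h A [P nP sPA].
have : \forall n \near \oo, forall i j, P i j (X n i j).
  by apply: filter_forall => i; apply: filter_forall => j; exact: h (nP i j).
by apply: filterS => n Pn; exact: sPA.
Qed.

Lemma mcvg_qf k (X : nat -> 'M[R]_k) Y x :
  mcvg X Y -> (fun n => qf (X n) x) @ \oo --> qf Y x.
Proof.
move=> h; rewrite /qf /dot.
by have := mcvgM (mcvg_cst x^T) (mcvgM h (mcvg_cst x)); apply.
Qed.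

Lemma mcvg_sym k (X : nat -> 'M[R]_k) Y :
  (forall n, symmx (X n)) -> mcvg X Y -> symmx Y.
Proof.
move=> sX h; apply: (mcvg_unique (mcvgT h)).
by rewrite (_ : (fun _ => _) = X) // funeqE => n; exact: sX.
Qed.

Arguments mcvg_qf {k X Y} x.

Lemma mcvg_psd k (X : nat -> 'M[R]_k) Y :
  (forall n, psd (X n)) -> mcvg X Y -> psd Y.
Proof.
move=> pX h; apply/psdP; split=> [|x].
  by apply: mcvg_sym h => n; have [] := pX n.
have hq := mcvg_qf x h; apply: (cvgr_to_ge hq).
by apply: nearW => n; have /psdP[_] := pX n; apply.
Qed.

Lemma polarize k (M : 'M[R]_k) i j : symmx M ->
  M i j = 2^-1 * (qf M (delta_mx i 0 + delta_mx j 0)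
          - qf M (delta_mx i 0) - qf M (delta_mx j 0)).
Proof.
move=> sM; have e a b : dot (delta_mx a 0) (M *m delta_mx b 0) = M a b.
  rewrite /dot trmx_delta -rowE -colE.
  by rewrite !mxE.
rewrite /qf mulmxDr !dot_lin !e.
have -> : M j i = M i j by rewrite -{1}sM mxE.
by field.
Qed.

(** Each [qf (X n) x] is a bounded nondecreasing real sequence, and polarization recovers the
    entries from such values. *)
Lemma monotone_mcvg k (X : nat -> 'M[R]_k) Z :
  (forall n, symmx (X n)) -> (forall n, loewner_le (X n) (X n.+1)) ->
  (forall n, loewner_le (X n) Z) -> exists Y, mcvg X Y.
Proof.
move=> sX mX bX.
have cq x : cvgn (fun n => qf (X n) x).
  apply: nondecreasing_is_cvgn.
    by apply/nondecreasing_seqP => n; exact: loewner_qf.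
  by exists (qf Z x) => _ [n _ <-]; exact: loewner_qf.
exists (\matrix_(i, j) (2^-1 * (limn (fun n => qf (X n) (delta_mx i 0 + delta_mx j 0))
   - limn (fun n => qf (X n) (delta_mx i 0)) - limn (fun n => qf (X n) (delta_mx j 0))))).
move=> i j; rewrite mxE; under eq_fun do rewrite polarize //.
by apply: cvgM; [exact: cvg_cst|apply: cvgB; [apply: cvgB|]; exact: cq].
Qed.

End Convergence.

Arguments mcvg_cst {R k l} Y.
Arguments mcvg_qf {R k X Y} x.

(** * Continuous-time algebraic Riccati equations *)

Section CARE.
Variables (R : realType) (k : nat).
Implicit Types A G H X Z : 'M[R]_k.

Definition care A G H X : 'M[R]_k := A^T *m X + X *m A - X *m G *m X + H.

Lemma care_sym A G H X : symmx G -> symmx H -> symmx X -> symmx (care A G H X).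
Proof.
move=> sG sH sX; rewrite /Defs.symmetric /care !(linearD, linearN) /=.
by rewrite !trmx_mul !trmxK sX sG sH mulmxA (addrC (X *m A)).
Qed.

Lemma qf_lyap A X x : symmx X ->
  qf (A^T *m X + X *m A) x = 2 * dot (X *m x) (A *m x).
Proof.
move=> sX; rewrite /qf mulmxDl dotDr -!mulmxA dot_mulr trmxK.
by rewrite (sym_dot x (A *m x) sX) (dotC (A *m x)); ring.
Qed.

Lemma qf_care A G H X x : symmx X -> qf (care A G H X) x =
  2 * dot (X *m x) (A *m x) - qf G (X *m x) + qf H x.
Proof.
move=> sX; rewrite /care !qfD qfN -qfD qf_lyap //; congr (_ - _ + _).
by rewrite /qf -!mulmxA sym_dot.
Qed.

(** Completing the square around [Z]: residuals at [X] and [Z] are compared along the closed loop of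
    [Z], with a remainder of known sign when [G] is semidefinite. *)
Lemma care_closed_loop A G H X Z x : symmx G -> symmx X -> symmx Z ->
  2 * dot ((X - Z) *m x) ((A - G *m Z) *m x) =
  qf (care A G H X) x - qf (care A G H Z) x + qf G ((X - Z) *m x).
Proof.
move=> sG sX sZ; rewrite !qf_care // !mulmxBl -mulmxA.
rewrite /qf !mulmxBr !dot_lin (sym_dot (Z *m x) (X *m x) sG).
by rewrite (dotC (G *m (Z *m x))); ring.
Qed.

Lemma care_compare A G H X Z : psd G -> symmx X -> symmx Z ->
  hurwitz (A - G *m Z) ->
  (forall x, qf (care A G H Z) x <= qf (care A G H X) x) -> loewner_le X Z.
Proof.
move=> /psdP[sG pG] sX sZ hZ hc; apply: (lyapunov_psd hZ) => [|x].
  by rewrite /Defs.symmetric linearB /= sX sZ.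
have := care_closed_loop A H x sG sX sZ.
rewrite -[Z - X]opprB mulNmx dotNl.
have := hc x; have := pG ((X - Z) *m x); lra.
Qed.

(* The PBH test for [(H, A)] with the eigenvector split as [a + i b]. *)
Definition real_detectable H A := forall al be (a b : 'cV[R]_k), 0 <= al ->
  A *m a = al *: a - be *: b -> A *m b = be *: a + al *: b ->
  H *m a = 0 -> H *m b = 0 -> a = 0 /\ b = 0.

(** On a mode with [al >= 0] the residual is a sum of nonnegative terms, so its sign forces [G Z]
    and [H] to vanish there. The mode then belongs to [A] and is invisible to [H], against
    detectability. *)
Lemma care_hurwitz A G H Z : psd G -> psd H -> psd Z -> real_detectable H A ->
  (forall x, qf (care A G H Z) x <= 0) -> hurwitz (A - G *m Z).
Proof.
move=> pG pH pZ dH hZ; apply: hurwitzI => al be a b nab ha hb.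
rewrite ltNge; apply/negP => al0; apply: nab.
have [sZ Z0] := (psdP Z).1 pZ.
have [sG G0] := (psdP G).1 pG; have [sH H0] := (psdP H).1 pH.
have e x : qf (care A G H Z) x =
    2 * dot (Z *m x) ((A - G *m Z) *m x) + qf G (Z *m x) + qf H x.
  by rewrite qf_care // mulmxBl !dot_lin -mulmxA /qf; ring.
(* The cross terms in [be] cancel by symmetry of [Z]. *)
have hab : dot (Z *m a) ((A - G *m Z) *m a) + dot (Z *m b) ((A - G *m Z) *m b)
    = al * (qf Z a + qf Z b).
  rewrite ha hb !dot_lin (dotC _ a) (dotC _ b) (dotC _ b) (dotC _ a).
  by rewrite (sym_dot a b sZ) (dotC _ b) /qf; ring.
have zab : 0 <= al * (qf Z a + qf Z b) by rewrite mulr_ge0 // addr_ge0.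
have := hZ a; have := hZ b; rewrite !e => h1 h2.
have := G0 (Z *m a); have := G0 (Z *m b); have := H0 a; have := H0 b => h3 h4 h5 h6.
have Ga : G *m (Z *m a) = 0 by apply: psd_null => //; lra.
have Gb : G *m (Z *m b) = 0 by apply: psd_null => //; lra.
have Ha : H *m a = 0 by apply: psd_null => //; lra.
have Hb : H *m b = 0 by apply: psd_null => //; lra.
move: ha hb; rewrite !mulmxBl -!mulmxA Ga Gb !subr0 => ha hb.
exact: dH al0 ha hb Ha Hb.
Qed.

(** [Z'] solves the Lyapunov equation of the closed loop of [Z] with cost [Z G Z + H]. Its residual
    is again nonpositive, so the step can be repeated. *)
Lemma newton_step A G H Z : psd G -> psd H -> psd Z -> real_detectable H A ->
  (forall x, qf (care A G H Z) x <= 0) ->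
  exists Z', [/\ psd Z', loewner_le Z' Z &
    forall x, qf (care A G H Z') x = - qf G ((Z' - Z) *m x)].
Proof.
move=> pG pH pZ dH hZ; have hA := care_hurwitz pG pH pZ dH hZ.
have [sZ Z0] := (psdP Z).1 pZ.
have [sG G0] := (psdP G).1 pG; have [sH H0] := (psdP H).1 pH.
have sE : symmx (Z *m G *m Z + H).
  by rewrite /Defs.symmetric linearD /= !trmx_mul sZ sG sH mulmxA.
have [Z' sZ' e] := lyapunov_solve hA sE.
have q x : 2 * dot (Z' *m x) ((A - G *m Z) *m x) + qf G (Z *m x) + qf H x = 0.
  have : qf ((A - G *m Z)^T *m Z' + Z' *m (A - G *m Z) + (Z *m G *m Z + H)) x = 0.
    by rewrite e qf0.
  rewrite qfD qf_lyap // qfD addrA => <-; congr (_ + _ + _).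
  by rewrite /qf -!mulmxA (sym_dot x _ sZ).
exists Z'; split.
- apply: (lyapunov_psd hA) => // x; have := q x.
  have := G0 (Z *m x); have := H0 x; lra.
- apply: (lyapunov_psd hA) => [|x].
    by rewrite /Defs.symmetric linearB /= sZ sZ'.
  have := hZ x; rewrite qf_care // => h; have := q x; rewrite !mulmxBl !dot_lin.
  have := h; rewrite -!mulmxA /qf; lra.
- move=> x; have := q x; rewrite qf_care // mulmxBl !dot_lin -mulmxA mulmxBl.
  rewrite /qf !mulmxBr !dot_lin (sym_dot (Z *m x) (Z' *m x) sG).
  rewrite (dotC (G *m (Z *m x))); lra.
Qed.

Lemma care_stab_sol A G H Z0 : psd G -> psd H -> psd Z0 -> real_detectable H A ->
  (forall x, qf (care A G H Z0) x <= 0) -> exists Z, psd Z /\ stab_sol A G H Z.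
Proof.
move=> pG pH pZ0 dH h0.
have sG := pG.1; have sH := pH.1; have /psdP[_ G0] := pG.
pose ok Z := psd Z /\ forall x, qf (care A G H Z) x <= 0.
(* Choice needs a total relation; outside [ok] the value [Z] is a dummy. *)
have step Z : exists Z', ok Z -> [/\ psd Z', loewner_le Z' Z &
    forall x, qf (care A G H Z') x = - qf G ((Z' - Z) *m x)].
  have [[pZ hZ]|nZ] := pselect (ok Z); last by exists Z.
  by have [Z' hZ'] := newton_step pG pH pZ dH hZ; exists Z'.
have [f hf] := boolp.choice step.
pose Z n := iter n f Z0.
have okZ n : ok (Z n).
  elim: n => [//|n /hf[p1 _ p2]]; split=> //= x.
  by rewrite p2 oppr_le0.
(* The iterates decrease and are bounded below by [0]; negation makes them increase. *)
have [Y hY] : exists Y, mcvg (fun n => - Z n) Y.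
  apply: (@monotone_mcvg _ _ _ 0) => n.
  - by rewrite /Defs.symmetric linearN /= (okZ n).1.1.
  - by rewrite /loewner_le opprK addrC; have [_ + _] := hf _ (okZ n).
  - by rewrite /loewner_le sub0r opprK; exact: (okZ n).1.
have {}hY : mcvg Z (- Y).
  by have := mcvgN hY; under eq_fun do rewrite opprK.
have pY : psd (- Y) by apply: mcvg_psd hY => n; exact: (okZ n).1.
have hc : mcvg (fun n => care A G H (Z n.+1)) (care A G H (- Y)).
  have hS := mcvgS hY.
  exact: (mcvgD (mcvgD (mcvgD (mcvgM (mcvg_cst A^T) hS) (mcvgM hS (mcvg_cst A)))
    (mcvgN (mcvgM (mcvgM hS (mcvg_cst G)) hS))) (mcvg_cst H)).
(* The residual is quadratic in the increment of the iteration, which tends to [0]. *)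
have c0 : care A G H (- Y) = 0.
  apply: sym_qf0 => [|x]; first exact: care_sym pY.1.
  apply: (cvg_unique _ (mcvg_qf x hc)) => //.
  have hd : mcvg (fun n => (Z n.+1 - Z n) *m x) 0.
    rewrite -(mul0mx _ x) -(subrr (- Y)); apply: mcvgM (mcvg_cst x).
    exact: mcvgD (mcvgS hY) (mcvgN hY).
  have -> : (fun n => qf (care A G H (Z n.+1)) x) =
      (fun n => - qf G ((Z n.+1 - Z n) *m x)).
    by apply/funext => n; have [_ _ ->] := hf _ (okZ n).
  rewrite -oppr0; apply: cvgN; rewrite /qf /dot.
  have := mcvgM (mcvgT hd) (mcvgM (mcvg_cst G) hd); rewrite !mulmx0.
  by move=> /(_ 0 0); rewrite mxE.
exists (- Y); split=> //; split; first exact: pY.1.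
split; first exact: c0.
by apply: care_hurwitz pG pH pY dH _ => x; rewrite c0 qf0.
Qed.

End CARE.

(** * The frozen Riccati iteration *)

Section Riccati.
Variables (R : realType) (n m r : nat) (A Q : 'M[R]_n) (B L : 'M[R]_(n, m))
  (Rm : 'M[R]_m) (A0 : 'I_r -> 'M[R]_n) (B0 : 'I_r -> 'M[R]_(n, m)).
Hypothesis pRm : posdef Rm.
Hypothesis pQLR : psd (block_mx Q L L^T Rm).
Implicit Types X Y Z : 'M[R]_n.

Local Notation RcY := (Rc Rm B0).
Local Notation AY := (Ac A B L Rm A0 B0).
Local Notation GY := (Gc B Rm B0).
Local Notation HY := (Hc Q L Rm A0 B0).
Local Notation careY Y := (care (AY Y) (GY Y) (HY Y)).
Local Notation RicY := (Ric A Q B L Rm A0 B0).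

(** * Frozen coefficients and the Hamiltonian *)

Lemma sandwich_sym k (M : 'I_r -> 'M[R]_(n, k)) Y : symmx Y ->
  symmx (\sum_(i < r) (M i)^T *m Y *m M i).
Proof.
move=> sY; rewrite /Defs.symmetric linear_sum /=; apply: eq_bigr => i _.
by rewrite !trmx_mul trmxK sY mulmxA.
Qed.

Lemma qf_sandwich k (M : 'I_r -> 'M[R]_(n, k)) Y (x : 'cV[R]_k) :
  qf (\sum_(i < r) (M i)^T *m Y *m M i) x = \sum_(i < r) qf Y (M i *m x).
Proof.
rewrite /qf mulmx_suml dot_sumr; apply: eq_bigr => i _.
by rewrite -!mulmxA dot_mulr trmxK.
Qed.

Lemma Q_sym : symmx Q.
Proof.
by have := pQLR.1; rewrite /Defs.symmetric tr_block_mx => /eq_block_mx[].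
Qed.

Lemma Rc_posdef Y : psd Y -> posdef (RcY Y).
Proof.
move=> /psdP[sY Y0]; have [sR R0] := (posdefP Rm).1 pRm.
apply/posdefP; split=> [|x x0].
  by rewrite /Defs.symmetric linearD /= sR sandwich_sym.
by rewrite qfD qf_sandwich ltr_pwDl ?R0 // sumr_ge0.
Qed.

Lemma Gc_psd Y : psd Y -> psd (GY Y).
Proof.
move=> /Rc_posdef/posdef_inv/posdef_psd/psdP[sP P0].
apply/psdP; split=> [|x].
  by rewrite /Defs.symmetric /Gc !trmx_mul trmxK sP mulmxA.
by rewrite /qf -!mulmxA dot_mulr; exact: P0.
Qed.

Lemma Qc_sym Y : psd Y -> symmx (Qc Q A0 Y).
Proof.
by move=> pY; rewrite /Defs.symmetric linearD /= Q_sym /Pi11 (sandwich_sym _ pY.1).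
Qed.

Lemma Hc_sym Y : psd Y -> symmx (HY Y).
Proof.
move=> pY; have sP := (posdef_inv (Rc_posdef pY)).1.
by rewrite /Defs.symmetric /Hc linearB /= Qc_sym // !trmx_mul trmxK sP mulmxA.
Qed.

(* The generator plus running cost at state [x] and input [u]: its minimum over [u] is the Riccati form, attained at [opt_input]. *)
Definition hamiltonian Y X (x : 'cV[R]_n) (u : 'cV[R]_m) :=
  2 * dot (X *m x) (A *m x + B *m u) + qf Q x + 2 * dot x (L *m u) + qf Rm u
  + \sum_(i < r) qf Y (A0 i *m x + B0 i *m u).

Definition opt_input Y X (x : 'cV[R]_n) : 'cV[R]_m :=
  - (invmx (RcY Y) *m (B^T *m (X *m x) + (Lc L A0 B0 Y)^T *m x)).

Lemma hamiltonianE Y X x u : symmx Y -> hamiltonian Y X x u =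
  2 * dot (X *m x) (A *m x) + qf (Qc Q A0 Y) x
  + 2 * dot (B^T *m (X *m x) + (Lc L A0 B0 Y)^T *m x) u + qf (RcY Y) u.
Proof.
move=> sY; rewrite /hamiltonian /Qc /Rc !qfD !qf_sandwich.
have -> : \sum_(i < r) qf Y (A0 i *m x + B0 i *m u) =
  \sum_(i < r) qf Y (A0 i *m x) + 2 * dot x (Pi12 A0 B0 Y *m u)
  + \sum_(i < r) qf Y (B0 i *m u).
  rewrite mulmx_suml dot_sumr mulr_sumr -!big_split; apply: eq_bigr => i _ /=.
  rewrite -!mulmxA dot_mulr trmxK /qf mulmxDr !dot_lin.
  rewrite (sym_dot (B0 i *m u) (A0 i *m x) sY).
  by rewrite (dotC (Y *m (B0 i *m u)) (A0 i *m x)); ring.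
have -> : dot (B^T *m (X *m x) + (Lc L A0 B0 Y)^T *m x) u =
    dot (X *m x) (B *m u) + dot x (L *m u) + dot x (Pi12 A0 B0 Y *m u).
  rewrite -addrA -dotDr -mulmxDl dotDl [in RHS]dot_mulr.
  by rewrite [in X in _ = _ + X]dot_mulr.
by rewrite dotDr; ring.
Qed.

Lemma Rc_inv_qf Y w : psd Y ->
  qf (RcY Y) (invmx (RcY Y) *m w) = qf (invmx (RcY Y)) w.
Proof.
move=> pY; have uP := posdef_unit (Rc_posdef pY).
by rewrite /qf mulKVmx // [LHS]dotC.
Qed.

(** The subtracted square expands into a cross term, coming from [Ac], and two pure terms, coming
    from [Gc] and [Hc]. *)
Lemma qf_care_gain Y X x : psd Y -> symmx X ->
  qf (careY Y X) x = 2 * dot (X *m x) (A *m x) + qf (Qc Q A0 Y) x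
    - qf (invmx (RcY Y)) (B^T *m (X *m x) + (Lc L A0 B0 Y)^T *m x).
Proof.
move=> pY sX; have sP := (posdef_inv (Rc_posdef pY)).1.
rewrite qf_care // /Ac /Hc qfD qfN mulmxBl dotDr dotNr.
set P := invmx _ in sP *; set l := (Lc L A0 B0 Y)^T *m x.
set b := B^T *m (X *m x).
have -> : dot (X *m x) (B *m P *m (Lc L A0 B0 Y)^T *m x) = dot b (P *m l).
  by rewrite -!mulmxA dot_mulr.
have -> : qf (GY Y) (X *m x) = qf P b by rewrite /qf /Gc -!mulmxA dot_mulr.
have -> : qf (Lc L A0 B0 Y *m P *m (Lc L A0 B0 Y)^T) x = qf P l.
  by rewrite /qf -!mulmxA dot_mulr.
rewrite /qf !mulmxDr !dot_lin (sym_dot l b sP) (dotC (P *m l)); ring.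
Qed.

(** The gap is the form of [Rc Y] at the deviation of [u] from [opt_input]. *)
Lemma care_le_hamiltonian Y X x u : psd Y -> symmx X ->
  qf (careY Y X) x <= hamiltonian Y X x u.
Proof.
move=> pY sX; rewrite (hamiltonianE _ _ _ pY.1) qf_care_gain //.
have uP := posdef_unit (Rc_posdef pY).
move: (B^T *m _ + _) => w.
have /psdP[sR /(_ (u + invmx (RcY Y) *m w))] := posdef_psd (Rc_posdef pY).
rewrite {1}/qf mulmxDr !dot_lin mulKVmx // (sym_dot (invmx (RcY Y) *m w) u sR) mulKVmx //.
rewrite (dotC u w) (dotC _ w) -/(qf _ u) -/(qf _ w); lra.
Qed.

Lemma hamiltonian_opt Y X x : psd Y -> symmx X ->
  hamiltonian Y X x (opt_input Y X x) = qf (careY Y X) x.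
Proof.
move=> pY sX; rewrite (hamiltonianE _ _ _ pY.1) qf_care_gain // /opt_input.
rewrite dotNr -/(qf _ _) [X in _ + X](_ : _ = qf (invmx (RcY Y))
   (B^T *m (X *m x) + (Lc L A0 B0 Y)^T *m x)); first ring.
by rewrite -Rc_inv_qf // /qf mulmxN dotNl dotNr opprK.
Qed.

Lemma hamiltonian_mono Y Z X x u :
  loewner_le Y Z -> hamiltonian Y X x u <= hamiltonian Z X x u.
Proof. by move=> h; rewrite lerD2l; apply: ler_sum => i _; exact: loewner_qf. Qed.

(** The optimal input for [Z] is admissible, though perhaps not optimal, for [Y]. *)
Lemma care_mono Y Z X x : psd Y -> psd Z -> loewner_le Y Z -> symmx X ->
  qf (careY Y X) x <= qf (careY Z X) x.
Proof.
move=> pY pZ hYZ sX; rewrite -(hamiltonian_opt x pZ sX).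
exact: le_trans (care_le_hamiltonian _ _ pY sX) (hamiltonian_mono _ _ _ hYZ).
Qed.

Lemma care_Ric Y : psd Y -> careY Y Y = RicY Y.
Proof.
move=> pY; have sY := pY.1; have sP := (posdef_inv (Rc_posdef pY)).1.
have -> : RicY Y = (A^T *m Y + Y *m A) + Qc Q A0 Y
    - (Y *m B + Lc L A0 B0 Y) *m invmx (RcY Y) *m (Y *m B + Lc L A0 B0 Y)^T.
  by rewrite /Ric -(addrA _ Q) -(addrA _ L).
have tW : (Y *m B + Lc L A0 B0 Y)^T = B^T *m Y + (Lc L A0 B0 Y)^T.
  by rewrite linearD /= trmx_mul sY.
move: (Y *m B + _) tW => W tW.
apply: sym_qf_inj => [||x].
- by apply: care_sym => //; [exact: (Gc_psd pY).1 | exact: Hc_sym].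
- rewrite /Defs.symmetric linearB linearD /= Qc_sym // !trmx_mul trmxK sP mulmxA.
  by rewrite linearD /= !trmx_mul trmxK sY addrC (addrC (Y *m A)) addrC.
rewrite qf_care_gain // [RHS]qfD qfN [in RHS]qfD qf_lyap //; congr (_ - _).
by rewrite [RHS]/qf -!mulmxA [RHS]dot_mulr tW mulmxDl -!mulmxA.
Qed.

Lemma Hc_care0 Y x : qf (HY Y) x = qf (careY Y 0) x.
Proof. by rewrite /care !(mulmx0, mul0mx) subr0 !add0r. Qed.

(** For [X = 0] the Hamiltonian consists of the running cost, nonnegative by the block hypothesis at
    the stacked vector of [x] and [u], and the noise terms. *)
Lemma Hc_psd Y : psd Y -> psd (HY Y).
Proof.
move=> pY; have s0 : symmx (0 : 'M[R]_n) by exact: trmx0.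
apply/psdP; split=> [|x]; first exact: Hc_sym.
rewrite Hc_care0 -hamiltonian_opt // /hamiltonian mul0mx dot0l mulr0 add0r.
set u := opt_input _ _ _.
apply: addr_ge0; last first.
  by apply: sumr_ge0 => i _; have /psdP[_] := pY; apply.
have /psdP[_ /(_ (col_mx x u))] := pQLR.
rewrite {1}/qf mul_block_col dot_col_mx !dotDr.
by rewrite (dotC u (L^T *m x)) -dot_mulr /qf; lra.
Qed.

Lemma Hc0 : HY 0 = Q - L *m invmx Rm *m L^T.
Proof.
have z a b (M : 'I_r -> 'M[R]_(n, a)) (N : 'I_r -> 'M[R]_(n, b)) :
    \sum_(i < r) (M i)^T *m (0 : 'M[R]_n) *m N i = 0.
  by apply: big1 => i _; rewrite mulmx0 mul0mx.
by rewrite /Hc /Qc /Lc /Rc /Pi11 /Pi12 /Pi22 !z !addr0.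
Qed.

(** By monotonicity the form of [HY 0] lies between [0] and that of [HY Y]. *)
Lemma Hc_null Y (x : 'cV[R]_n) : psd Y -> HY Y *m x = 0 -> HY 0 *m x = 0.
Proof.
move=> pY Hx; have p0 : psd (HY 0) := Hc_psd (psd0 R n).
apply: psd_null => //.
apply/eqP; rewrite eq_le; have /psdP[_ ->] := p0; rewrite andbT.
have -> : 0 = qf (HY Y) x by rewrite /qf Hx dot0r.
rewrite !Hc_care0; apply: care_mono => //; [exact: psd0 | | exact: trmx0].
by rewrite /loewner_le subr0.
Qed.

Hypothesis null_Hc0 : forall x : 'cV[R]_n, (Q - L *m invmx Rm *m L^T) *m x = 0 ->
  L^T *m x = 0 /\ forall i, A0 i *m x = 0.
Hypothesis det_Hc0 : detectable (Q - L *m invmx Rm *m L^T) A.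

Lemma Ac_null Y (x : 'cV[R]_n) : HY 0 *m x = 0 -> AY Y *m x = A *m x.
Proof.
rewrite Hc0 => /null_Hc0[Lx A0x].
rewrite /Ac mulmxBl -!mulmxA (_ : (Lc L A0 B0 Y)^T *m x = 0) ?(mulmx0, subr0) //.
rewrite linearD /= mulmxDl Lx add0r linear_sum /= mulmx_suml big1 // => i _.
by rewrite !trmx_mul trmxK -!mulmxA A0x !mulmx0.
Qed.

(** A mode of [AY Y] killed by [HY Y] is killed by [HY 0], where [AY Y] agrees with [A]; the
    detectability hypothesis then applies. *)
Lemma Hc_detectable Y : psd Y -> real_detectable (HY Y) (AY Y).
Proof.
move=> pY al be a b al0 ha hb /(Hc_null pY) Ha /(Hc_null pY) Hb.
move: ha hb; rewrite !Ac_null // => ha hb.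
by rewrite Hc0 in Ha Hb; exact: detectable_real det_Hc0 al0 ha hb Ha Hb.
Qed.

Lemma closed_loop_hurwitz Y Z : psd Y -> psd Z ->
  (forall x, qf (careY Y Z) x <= 0) -> hurwitz (AY Y - GY Y *m Z).
Proof.
move=> pY pZ; apply: care_hurwitz => //.
- exact: Gc_psd.
- exact: Hc_psd.
- exact: Hc_detectable.
Qed.

(** * Invariants and limit of the iteration *)

Variable Xs : 'M[R]_n.
Hypothesis pXs : psd Xs.
Hypothesis RicXs : RicY Xs = 0.
Hypothesis Xs_unique : forall Y, psd Y -> RicY Y = 0 -> Y = Xs.

Lemma care_Xs_le0 Y x : psd Y -> loewner_le Y Xs -> qf (careY Y Xs) x <= 0.
Proof.
move=> pY hY; rewrite -(qf0 x) -RicXs -care_Ric //.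
exact: care_mono pXs.1.
Qed.

Lemma step_exists Y : psd Y -> loewner_le Y Xs ->
  exists Z, stab_sol (AY Y) (GY Y) (HY Y) Z.
Proof.
move=> pY hY.
have [] := care_stab_sol (Gc_psd pY) (Hc_psd pY) pXs (Hc_detectable pY).
  by move=> x; exact: care_Xs_le0.
by move=> Z [_ hZ]; exists Z.
Qed.

(** In the equation frozen at [Y] the residuals at [Y], [Z], [Xs] are nonnegative, zero and
    nonpositive, and the closed loops of [Z] and [Xs] are Hurwitz, so [care_compare] orders the
    three. Refreezing at [Z >= Y] raises the residual of [Z] from zero. *)
Lemma step_invariants Y Z : psd Y -> loewner_le Y Xs -> psd (RicY Y) ->
  stab_sol (AY Y) (GY Y) (HY Y) Z ->
  [/\ loewner_le Y Z, loewner_le Z Xs, psd Z & psd (RicY Z)].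
Proof.
move=> pY hY pRY [sZ [eZ hZ]]; have cZ : careY Y Z = 0 by [].
have YZ : loewner_le Y Z.
  apply: (care_compare (H := HY Y) (Gc_psd pY) _ sZ hZ) => [|x]; first exact: pY.1.
  by rewrite cZ qf0 care_Ric //; have /psdP[_] := pRY; apply.
have ZXs : loewner_le Z Xs.
  apply: (care_compare (H := HY Y) (Gc_psd pY) sZ pXs.1).
    by apply: closed_loop_hurwitz => // x; exact: care_Xs_le0.
  by move=> x; rewrite cZ qf0 care_Xs_le0.
have pZ : psd Z.
  apply/psdP; split=> // x; apply: le_trans (loewner_qf x YZ).
  by have /psdP[_] := pY; apply.
split=> //; rewrite -care_Ric //; apply/psdP; split=> [|x].
  by apply: care_sym => //; [exact: (Gc_psd pZ).1 | exact: Hc_sym].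
by rewrite -(qf0 x) -cZ care_mono.
Qed.

Lemma Ric0_psd : psd (RicY 0).
Proof.
have p0 := psd0 R n; rewrite -care_Ric //; apply/psdP; split=> [|x].
  apply: care_sym; [exact: (Gc_psd p0).1 | exact: Hc_sym | exact: p0.1].
by rewrite -Hc_care0; have /psdP[_] := Hc_psd p0; apply.
Qed.

Lemma mcvg_sandwich a b (M : 'I_r -> 'M[R]_(n, a)) (N : 'I_r -> 'M[R]_(n, b))
    (X : nat -> 'M[R]_n) Y : mcvg X Y ->
  mcvg (fun k => \sum_(i < r) (M i)^T *m X k *m N i)
       (\sum_(i < r) (M i)^T *m Y *m N i).
Proof.
move=> h; have hi i := mcvgM (mcvgM (mcvg_cst (M i)^T) h) (mcvg_cst (N i)).
exact: (mcvg_sum (s := index_enum 'I_r) hi).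
Qed.

(** Two sequences are allowed because the recursion couples [X k] with [X k.+1]; semidefiniteness
    keeps every [Rc] invertible. *)
Lemma mcvg_care (X Z : nat -> 'M[R]_n) Y W :
  (forall k, psd (X k)) -> psd Y -> mcvg X Y -> mcvg Z W ->
  mcvg (fun k => careY (X k) (Z k)) (careY Y W).
Proof.
move=> pX pY hX hZ.
have hP : mcvg (fun k => invmx (RcY (X k))) (invmx (RcY Y)).
  apply: mcvg_inv => [k||]; [exact/posdef_unit/Rc_posdef.. |].
  exact: mcvgD (mcvg_cst Rm) (mcvg_sandwich hX).
have hL : mcvg (fun k => Lc L A0 B0 (X k)) (Lc L A0 B0 Y).
  exact: mcvgD (mcvg_cst L) (mcvg_sandwich hX).
have hA : mcvg (fun k => AY (X k)) (AY Y).
  exact: mcvgD (mcvg_cst A) (mcvgN (mcvgM (mcvgM (mcvg_cst B) hP) (mcvgT hL))).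
have hG : mcvg (fun k => GY (X k)) (GY Y).
  exact: mcvgM (mcvgM (mcvg_cst B) hP) (mcvg_cst B^T).
have hH : mcvg (fun k => HY (X k)) (HY Y).
  exact: mcvgD (mcvgD (mcvg_cst Q) (mcvg_sandwich hX))
    (mcvgN (mcvgM (mcvgM hL hP) (mcvgT hL))).
exact: mcvgD (mcvgD (mcvgD (mcvgM (mcvgT hA) hZ) (mcvgM hZ hA))
  (mcvgN (mcvgM (mcvgM hZ hG) hZ))) hH.
Qed.

Lemma iteration_exists : exists X : nat -> 'M[R]_n, X 0%N = 0 /\
  forall k, stab_sol (AY (X k)) (GY (X k)) (HY (X k)) (X k.+1).
Proof.
pose ok Y := [/\ psd Y, loewner_le Y Xs & psd (RicY Y)].
have step Y : exists Z, ok Y -> stab_sol (AY Y) (GY Y) (HY Y) Z.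
  have [[pY hY _]|nY] := pselect (ok Y); last by exists Y.
  by have [Z hZ] := step_exists pY hY; exists Z.
have [f hf] := boolp.choice step.
have okf k : ok (iter k f 0).
  elim: k => [|k oki] /=.
    by split; rewrite ?/loewner_le ?subr0 //; [exact: psd0 | exact: Ric0_psd].
  have [pY hY rY] := oki.
  by have [_ h1 h2 h3] := step_invariants pY hY rY (hf _ oki).
by exists (fun k => iter k f 0); split=> // k; exact/hf/okf.
Qed.

Lemma iteration_invariants (X : nat -> 'M[R]_n) : X 0%N = 0 ->
  (forall k, stab_sol (AY (X k)) (GY (X k)) (HY (X k)) (X k.+1)) ->
  forall k, [/\ psd (X k), loewner_le (X k) Xs & psd (RicY (X k))].
Proof.
move=> X0 hX; elim=> [|k [pY hY rY]].
  by rewrite X0 /loewner_le subr0; split=> //; [exact: psd0 | exact: Ric0_psd].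
by have [_ h1 h2 h3] := step_invariants pY hY rY (hX k).
Qed.

Lemma iteration_cvg (X : nat -> 'M[R]_n) : X 0%N = 0 ->
  (forall k, stab_sol (AY (X k)) (GY (X k)) (HY (X k)) (X k.+1)) ->
  mcvg X Xs.
Proof.
move=> X0 hX; have inv := iteration_invariants X0 hX.
have pX k : psd (X k) by have [] := inv k.
have [Y hY] : exists Y, mcvg X Y.
  apply: (@monotone_mcvg _ _ _ Xs) => k.
  - exact: (pX k).1.
  - have [p1 p2 p3] := inv k.
    by have [] := step_invariants p1 p2 p3 (hX k).
  - by have [] := inv k.
have pY := mcvg_psd pX hY.
suff <- : Y = Xs by [].
apply: Xs_unique => //; rewrite -care_Ric //.
(* The residual frozen at [X k] is zero at [X k.+1] for every [k], and both arguments tend to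
   [Y]. *)
apply: (mcvg_unique (mcvg_care pX pY hY (mcvgS hY))).
rewrite (_ : (fun _ => _) = fun=> 0); first exact: mcvg_cst.
by apply/funext => k; have [_ []] := hX k.
Qed.

End Riccati.

Theorem theorem3p3 (R : realType) (n m r p : nat)
  (A Q : 'M[R]_n) (B L : 'M[R]_(n, m)) (Rm : 'M[R]_m)
  (A0 : 'I_r -> 'M[R]_n) (B0 : 'I_r -> 'M[R]_(n, m))
  (C : 'M[R]_(p, n)) (Xs : 'M[R]_n) :
  (* (1) *)
  posdef Rm -> psd (block_mx Q L L^T Rm) ->
  (* (2) *)
  (exists F : 'M[R]_(m, n),
     exp_stable (fun S : 'M[R]_n =>
       (A + B *m F) *m S + S *m (A + B *m F)^T
       + \sum_(i < r) (A0 i + B0 i *m F) *m S *m (A0 i + B0 i *m F)^T)) ->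
  (* (3) *)
  C^T *m C = Q - L *m invmx Rm *m L^T ->
  (exists K : 'M[R]_(n, p),
     exp_stable (fun S : 'M[R]_n =>
       (A - B *m invmx Rm *m L^T + K *m C) *m S
       + S *m (A - B *m invmx Rm *m L^T + K *m C)^T
       + \sum_(i < r) (A0 i - B0 i *m invmx Rm *m L^T) *m S
                        *m (A0 i - B0 i *m invmx Rm *m L^T)^T)) ->
  (* (4) *)
  (forall x : 'cV[R]_n, (Q - L *m invmx Rm *m L^T) *m x = 0 ->
     L^T *m x = 0 /\ forall i, A0 i *m x = 0) ->
  (* (5) *)
  stabilizable A B -> detectable (Q - L *m invmx Rm *m L^T) A ->
  (* X_* : the unique positive semidefinite solution of R(X) = 0 *)
  psd Xs -> Ric A Q B L Rm A0 B0 Xs = 0 ->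
  (forall Y : 'M[R]_n, psd Y -> Ric A Q B L Rm A0 B0 Y = 0 -> Y = Xs) ->
  (* the iteration is well defined ... *)
  (exists X : nat -> 'M[R]_n, X 0%N = 0 /\
     forall k, stab_sol (Ac A B L Rm A0 B0 (X k)) (Gc B Rm B0 (X k))
                        (Hc Q L Rm A0 B0 (X k)) (X k.+1)) /\
  (* ... and every such sequence satisfies (i) and (ii) *)
  (forall X : nat -> 'M[R]_n, X 0%N = 0 ->
     (forall k, stab_sol (Ac A B L Rm A0 B0 (X k)) (Gc B Rm B0 (X k))
                         (Hc Q L Rm A0 B0 (X k)) (X k.+1)) ->
     (forall k, loewner_le (X k) (X k.+1) /\ loewner_le (X k) Xs /\
        psd (Ric A Q B L Rm A0 B0 (X k)) /\
        hurwitz (Ac A B L Rm A0 B0 (X k) - Gc B Rm B0 (X k) *m Xs)) /\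
     (X @ \oo --> Xs) /\ psd Xs /\
     (forall z : R[i],
        eigenvalue (cmx (Ac A B L Rm A0 B0 Xs - Gc B Rm B0 Xs *m Xs)) z ->
        Re z <= 0)).
Proof.
move=> pR pQLR _ _ _ h4 _ h5 pXs RicXs uXs.
split; first exact: (iteration_exists pR pQLR h4 h5 pXs RicXs).
move=> X X0 hX.
have inv := iteration_invariants pR pQLR h4 h5 pXs RicXs X0 hX.
split=> [k|].
  have [p1 p2 p3] := inv k.
  have [YZ _ _ _] := step_invariants pR pQLR h4 h5 pXs RicXs p1 p2 p3 (hX k).
  split=> //; split=> //; split=> //.
  apply: (closed_loop_hurwitz pR pQLR h4 h5 p1 pXs) => x.
  exact: (care_Xs_le0 pR pQLR pXs RicXs).
split; first exact/mcvg_cvg/(iteration_cvg pR pQLR h4 h5 pXs RicXs uXs X0 hX).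
(* The limiting closed loop is shown to be Hurwitz, and the strict bound is then weakened. *)
split=> // z hz; apply: ltW; move: z hz.
apply: (closed_loop_hurwitz pR pQLR h4 h5 pXs pXs) => x.
by rewrite (care_Ric A B A0 B0 pR pQLR pXs) RicXs qf0.
Qed.
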